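(* Let $R$ be a left GF-closed ring and let $0\to A\to B\to C\to 0$ be a short exact sequence of left $R$-modules. Then: (1) If any two of the modules $A$, $B$, $C$ have finite Gorenstein flat dimension, then so has the third. (2) $\mathrm{Gfd}_R(A)\le \sup\{\mathrm{Gfd}_R(B),\mathrm{Gfd}_R(C)-1\}$, with equality if $\mathrm{Gfd}_R(B)\neq \mathrm{Gfd}_R(C)$. (3) $\mathrm{Gfd}_R(B)\le \sup\{\mathrm{Gfd}_R(A),\mathrm{Gfd}_R(C)\}$, with equality if $\mathrm{Gfd}_R(C)\neq \mathrm{Gfd}_R(A)+1$. (4) $\mathrm{Gfd}_R(C)\le \sup\{\mathrm{Gfd}_R(B),\mathrm{Gfd}_R(A)+1\}$, with equality if $\mathrm{Gfd}_R(B)\neq \mathrm{Gfd}_R(A)$.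
   Context: All rings are associative with identity and all modules are unitary. A left $R$-module $M$ is Gorenstein flat if there exists an exact sequence of flat left $R$-modules $\cdots\to F_1\to F_0\to F^0\to F^1\to\cdots$ such that $M\cong \mathrm{Im}(F_0\to F^0)$ and such that $I\otimes_R -$ leaves the sequence exact whenever $I$ is an injective right $R$-module. For an integer $n\ge 0$, $\mathrm{Gfd}_R(M)\le n$ means that there is an exact sequence of left $R$-modules $0\to G_n\to\cdots\to G_0\to M\to 0$ with each $G_i$ Gorenstein flat; $\mathrm{Gfd}_R(M)$ (the Gorenstein flat dimension) is the least such $n$, and $\infty$ if there is none (with $\infty\pm 1=\infty$). A ring $R$ is left GF-closed if the class of Gorenstein flat left $R$-modules is closed under extensions: for every short exact sequence of left $R$-modules $0\to A\to B\to C\to 0$ with $A$ and $C$ Gorenstein flat, $B$ is Gorenstein flat. *)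

(* Defs.v *)
From HB Require Import structures.
From mathcomp Require Import all_boot all_order all_algebra.
From mathcomp Require Import boolp constructive_ereal.
From mathcomp Require Import freeg.

Set Implicit Arguments.
Unset Strict Implicit.
Unset Printing Implicit Defensive.

Import Order.TTheory GRing.Theory Num.Theory.
Local Open Scope ring_scope.
Local Open Scope quotient_scope.

(* Left R-modules are [lmodType R]; right R-modules are [lmodType R^c], the
   right action x.a being written [(a : R^c) *: x].  Rings are [pzRingType],
   so the zero ring is allowed. *)

Definition exact (U V W : zmodType) (f : U -> V) (g : V -> W) : Prop :=
  forall v : V, g v = 0 <-> exists u : U, f u = v.

Definition short_exact (U V W : zmodType) (f : U -> V) (g : V -> W) : Prop :=
  [/\ injective f, exact f g & forall w : W, exists v : V, g v = w].

(* ... -> X 1 -> X 0 -e-> Y 0 -> Y 1 -> ... is exact everywhere. *)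
Definition exact_biinfinite (X Y : nat -> zmodType)
    (dX : forall n, X n.+1 -> X n) (e : X 0%N -> Y 0%N)
    (dY : forall n, Y n -> Y n.+1) : Prop :=
  [/\ forall n, exact (dX n.+1) (dX n),
      exact (dX 0%N) e,
      exact e (dY 0%N)
    & forall n, exact (dY n) (dY n.+1)].

(* The tensor product of a right module and a left module: the free abelian
    group on [I * M] modulo the subgroup generated by the usual relators. *)
Section Tensor.
Variables (R : pzRingType) (I : lmodType R^c) (M : lmodType R).

Inductive tensor_relator : {freeg (I * M)%type / int} -> Prop :=
| TRaddl (x x' : I) (y : M) :
    tensor_relator (<< (x + x', y) >> - << (x, y) >> - << (x', y) >>)
| TRaddr (x : I) (y y' : M) :
    tensor_relator (<< (x, y + y') >> - << (x, y) >> - << (x, y') >>)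
| TRmid (x : I) (a : R) (y : M) :
    tensor_relator (<< ((a : R^c) *: x, y) >> - << (x, a *: y) >>).

Inductive tensor_null_spec : {freeg (I * M)%type / int} -> Prop :=
| TNrelator z : tensor_relator z -> tensor_null_spec z
| TNzero : tensor_null_spec 0
| TNsub z z' :
    tensor_null_spec z -> tensor_null_spec z' -> tensor_null_spec (z - z').

Definition tensor_null : {pred {freeg (I * M)%type / int}} :=
  fun z => `[< tensor_null_spec z >].

Lemma tensor_null_zmod_closed : zmod_closed tensor_null.
Proof.
split; first by apply/asboolP; exact: TNzero.
move=> z z' /asboolP hz /asboolP hz'; apply/asboolP; exact: TNsub.
Qed.

HB.instance Definition _ :=
  GRing.isZmodClosed.Build _ tensor_null tensor_null_zmod_closed.

Definition tensor : zmodType := Quotient.quot tensor_null.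

Definition tensor_class (z : {freeg (I * M)%type / int}) : tensor :=
  \pi_(Quotient.quot tensor_null) z.

Definition tens (x : I) (y : M) : tensor := tensor_class << (x, y) >>.

Definition balanced (G : zmodType) (b : I -> M -> G) : Prop :=
  [/\ forall x x' y, b (x + x') y = b x y + b x' y,
      forall x y y', b x (y + y') = b x y + b x y'
    & forall x (a : R) y, b ((a : R^c) *: x) y = b x (a *: y)].

Lemma tensor_classP z z' :
  tensor_class z = tensor_class z' <-> tensor_null_spec (z - z').
Proof.
split=> [/eqP|h]; last apply/eqP.
  by rewrite -Quotient.idealrBE => /asboolP.
by rewrite -Quotient.idealrBE; apply/asboolP.
Qed.

Lemma tensor_class_repr t : tensor_class (repr t) = t.
Proof. exact: reprK. Qed.

Lemma tensor_classB : {morph tensor_class : z z' / z - z'}.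
Proof.
by move=> z z'; exact: (raddfB (\pi_(Quotient.quot tensor_null))).
Qed.

HB.instance Definition _ :=
  GRing.isZmodMorphism.Build _ _ tensor_class tensor_classB.

Lemma tens_balanced : balanced tens.
Proof.
split=> [x x' y|x y y'|x a y]; rewrite /tens.
- rewrite -[RHS](raddfD tensor_class); apply/tensor_classP/TNrelator.
  by rewrite opprD addrA; exact: TRaddl.
- rewrite -[RHS](raddfD tensor_class); apply/tensor_classP/TNrelator.
  by rewrite opprD addrA; exact: TRaddr.
- by apply/tensor_classP/TNrelator; exact: TRmid.
Qed.

Lemma tensor_ind (P : tensor -> Prop) :
    P 0 -> (forall s t, P s -> P t -> P (s + t)) ->
    (forall x y, P (tens x y)) -> forall t, P t.
Proof.
move=> P0 PD Pt t; rewrite -[t]tensor_class_repr.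
have Pn n x y : P (tensor_class (<< n%:Z *g (x, y) >>)).
  elim: n => [|n IHn]; first by rewrite freegU0 (raddf0 tensor_class).
  rewrite -addn1 PoszD -freegUD (raddfD tensor_class); apply: PD => //.
  exact: Pt.
have [tD tD' tZ] := tens_balanced.
have tN x y : tens (- x) y = - tens x y.
  apply/eqP; rewrite -subr_eq0 opprK -tD addNr; apply/eqP.
  by apply: (addIr (tens 0 y)); rewrite -tD !add0r.
rewrite -(freeg_sumE (repr t)) (raddf_sum tensor_class).
elim/big_ind: _ => // -[x y] _.
case: (coeff _ _) => n; first exact: Pn.
rewrite NegzE -freegUN (raddfN tensor_class).
have -> : - tensor_class << n.+1%:Z *g (x, y) >>
        = tensor_class << n.+1%:Z *g (- x, y) >>.
  rewrite -[n.+1%:Z]natz -!freegU_muln !(raddfMn tensor_class).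
  by rewrite -[RHS]/(tens (- x) y *+ n.+1) tN mulNrn.
exact: Pn.
Qed.

(* Meaningful only when [b] is balanced: see [tensor_liftE]. *)
Definition tensor_lift (G : zmodType) (b : I -> M -> G) (t : tensor) : G :=
  fglift (fun p => b p.1 p.2 : zmodule G) (repr t).

Section Lift.
Variables (G : zmodType) (b : I -> M -> G) (hb : balanced b).
Let L : {freeg (I * M)%type / int} -> G :=
  fglift (fun p => b p.1 p.2 : zmodule G).

Let LB : {morph L : z z' / z - z'}.
Proof. exact: (lift_is_additive (fun p => b p.1 p.2 : zmodule G)). Qed.

Let LU x y : L << (x, y) >> = b x y.
Proof. by rewrite /L liftU scale1r. Qed.

Let L_null z : tensor_null_spec z -> L z = 0.
Proof.
have [bD bD' bZ] := hb.
elim=> [{}z| |{}z z' _ hz _ hz'].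
- case=> *; rewrite !LB !LU.
  + by rewrite bD -addrA -opprD subrr.
  + by rewrite bD' -addrA -opprD subrr.
  + by rewrite bZ subrr.
- by rewrite -[0](subrr 0) LB subrr.
- by rewrite LB hz hz' subrr.
Qed.

Let L_class z : tensor_lift b (tensor_class z) = L z.
Proof.
apply/eqP; rewrite -subr_eq0 -LB; apply/eqP/L_null/tensor_classP.
exact: tensor_class_repr.
Qed.

Lemma tensor_liftB : {morph tensor_lift b : s t / s - t}.
Proof.
move=> s t; rewrite -[s]tensor_class_repr -[t]tensor_class_repr.
by rewrite -(raddfB tensor_class) !L_class LB.
Qed.

Lemma tensor_liftE x y : tensor_lift b (tens x y) = b x y.
Proof. by rewrite L_class LU. Qed.

End Lift.

Lemma tensor_lift_unique (G : zmodType) (h h' : tensor -> G) :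
    {morph h : s t / s - t} -> {morph h' : s t / s - t} ->
    (forall x y, h (tens x y) = h' (tens x y)) -> h =1 h'.
Proof.
move=> hB hB' e t.
have h0 : h 0 = 0 by rewrite -[0](subrr 0) hB subrr.
have h0' : h' 0 = 0 by rewrite -[0](subrr 0) hB' subrr.
have hD s s' : h (s + s') = h s + h s'.
  by rewrite -[s' in LHS]opprK -[X in - X]sub0r !hB h0 opprB subr0 addrC.
have hD' s s' : h' (s + s') = h' s + h' s'.
  by rewrite -[s' in LHS]opprK -[X in - X]sub0r !hB' h0' opprB subr0 addrC.
by elim/tensor_ind: t => [|s s' es es'|//]; rewrite ?h0 ?h0' // hD hD' es es'.
Qed.

End Tensor.

Definition tensor_map (R : pzRingType) (I J : lmodType R^c) (M N : lmodType R)
    (f : {linear I -> J}) (g : {linear M -> N}) : tensor I M -> tensor J N :=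
  tensor_lift (fun x y => tens (f x) (g y)).

Section TensorMap.
Variables (R : pzRingType) (I J : lmodType R^c) (M N : lmodType R).
Variables (f : {linear I -> J}) (g : {linear M -> N}).

Lemma tensor_map_balanced : balanced (fun x y => tens (f x) (g y)).
Proof.
have [tD tD' tZ] := tens_balanced J N.
split=> [x x' y|x y y'|x a y].
- by rewrite linearD tD.
- by rewrite linearD tD'.
- by rewrite !linearZ; apply: tZ.
Qed.

Lemma tensor_mapE x y : tensor_map f g (tens x y) = tens (f x) (g y).
Proof. exact: tensor_liftE tensor_map_balanced x y. Qed.

Lemma tensor_mapB : {morph tensor_map f g : s t / s - t}.
Proof. exact: tensor_liftB tensor_map_balanced. Qed.

HB.instance Definition _ :=
  GRing.isZmodMorphism.Build (tensor I M) (tensor J N) (tensor_map f g)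
    tensor_mapB.

End TensorMap.

Definition flat (R : pzRingType) (M : lmodType R) : Prop :=
  forall (U V W : lmodType R^c) (f : {linear U -> V}) (g : {linear V -> W}),
    short_exact f g ->
    short_exact (tensor_map f (idfun : {linear M -> M}))
                (tensor_map g (idfun : {linear M -> M})).

Definition injective_module (S : pzRingType) (E : lmodType S) : Prop :=
  forall (U V : lmodType S) (i : {linear U -> V}) (h : {linear U -> E}),
    injective i -> exists k : {linear V -> E}, forall u, k (i u) = h u.

(* The isomorphism of [M] with the image of [e] is given as an injective linear
   map [m] into [Y 0] whose range is that of [e]. *)
Definition gorenstein_flat (R : pzRingType) (M : lmodType R) : Prop :=
  exists (X Y : nat -> lmodType R)
         (dX : forall n, {linear X n.+1 -> X n}) (e : {linear X 0%N -> Y 0%N})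
         (dY : forall n, {linear Y n -> Y n.+1}),
  [/\ forall n, flat (X n) /\ flat (Y n),
      exact_biinfinite (X := X) (Y := Y) dX e dY,
      exists m : {linear M -> Y 0%N},
        injective m /\ forall y, (exists x, m x = y) <-> (exists x, e x = y)
    & forall I : lmodType R^c, injective_module I ->
        exact_biinfinite
          (X := fun n => tensor I (X n)) (Y := fun n => tensor I (Y n))
          (fun n => tensor_map (idfun : {linear I -> I}) (dX n))
          (tensor_map (idfun : {linear I -> I}) e)
          (fun n => tensor_map (idfun : {linear I -> I}) (dY n))].

Definition left_GF_closed (R : pzRingType) : Prop :=
  forall (A B C : lmodType R) (f : {linear A -> B}) (g : {linear B -> C}),
    short_exact f g ->
    gorenstein_flat A -> gorenstein_flat C -> gorenstein_flat B.

(* The sequence 0 -> G n -> ... -> G 0 -> M -> 0 is extended by zero modules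
   [G i], [n < i], so that exactness at [G n] is injectivity of
   [G n -> G n.-1] (of [aug] if [n = 0]). *)
Definition gfd_le (R : pzRingType) (M : lmodType R) (n : nat) : Prop :=
  exists (G : nat -> lmodType R) (d : forall i, {linear G i.+1 -> G i})
         (aug : {linear G 0%N -> M}),
  [/\ forall i, (i <= n)%N -> gorenstein_flat (G i),
      forall i, (n < i)%N -> forall x : G i, x = 0,
      forall i, exact (d i.+1) (d i),
      exact (d 0%N) aug
    & forall x : M, exists y, aug y = x].

Definition Gfd (R : pzRingType) (M : lmodType R) : \bar int :=
  match pselect (exists n, `[< gfd_le M n >]) with
  | left h => ((ex_minn h)%:Z)%:E
  | right _ => +oo%E
  end.

(* Main.v *)
From HB Require Import structures.
Require Import Defs.
From mathcomp Require Import all_boot all_order all_algebra.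
From mathcomp Require Import boolp functions constructive_ereal zify.

Set Implicit Arguments.
Unset Strict Implicit.
Unset Printing Implicit Defensive.

Import Order.TTheory GRing.Theory Num.Theory.
Local Open Scope ring_scope.
Local Open Scope quotient_scope.

(** Two things are proved: over a left GF-closed ring the class of Gorenstein
    flat modules is closed under kernels of surjections
    ([gorenstein_flat_kernel]), and the inequalities between the dimensions
    follow formally from that, closure under extensions, and the existence of
    enough free modules, which are Gorenstein flat.

    Kernels.  Let 0 -> A -> B -> C -> 0 be exact with B and C Gorenstein flat.
    The right half of a complete flat resolution of B starts with
    0 -> B -> Y -> G -> 0, with Y flat and G Gorenstein flat.  The quotient
    D = Y / A is an extension of G by C, hence Gorenstein flat; this is where
    GF-closedness enters.
    It remains to see that A is Gorenstein flat when 0 -> A -> Y -> D -> 0 is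
    exact with Y flat and D Gorenstein flat ([gorenstein_flat_flat_syzygy]).  A
    complete flat resolution of A is obtained by splicing a free resolution of A
    with Y and the right half of the one of D.  Tensoring with an injective
    right module I keeps it exact because Tor_n(I, D) = 0 for n > 0, hence
    Tor_n(I, A) = 0 for n > 0.

    Tor.  Only the vanishing of Tor is needed.  Vanishing of Tor_1(J, M) is
    expressed with the canonical free cover of J ([tor1_zero]); the 3 x 3 lemma
    turns it into a condition on any flat cover of M
    ([tor1_zero_injective], [injective_tor1_zero]).  Higher Tor is reached by
    taking syzygies of the right module, so that dimension shifting in M
    ([tor1_zero_shift]) trades a syzygy of J for a syzygy of M and no comparison
    of resolutions is required.

    Dimensions.  For 0 -> A -> B -> C -> 0 one shows, for every n,
    - Gfd A <= n and Gfd C <= n give Gfd B <= n ([extension_bound]);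
    - Gfd B <= n and Gfd C <= n + 1 give Gfd A <= n ([kernel_bound]);
    - Gfd A <= n and Gfd B <= n + 1 give Gfd C <= n + 1 ([cokernel_bound]).
    Covering B and C by one free module F replaces the sequence by
    0 -> N -> D -> A -> 0, where N and D are the kernels of F -> B and F -> C
    ([common_free_cover]); this rotation makes a simultaneous induction work
    ([extension_kernel_bound]).  The three bounds are the inequalities of the
    theorem, and its finiteness and equality clauses follow from them by
    arithmetic. *)

(** * Submodules, kernels and cokernels *)

Definition linear_map (S : pzRingType) (U V : lmodType S) (h : U -> V)
    (h_lin : linear h) : {linear U -> V} :=
  HB.pack h (GRing.isLinear.Build S U V *:%R h h_lin).

Section Submodule.
Variables (S : pzRingType) (V : lmodType S) (P : submodClosed V).

Definition submodule := {x : V | x \in P}.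

HB.instance Definition _ := SubChoice.on submodule.
HB.instance Definition _ := [SubChoice_isSubLmodule of submodule by <:].

Definition submodule_incl : {linear submodule -> V} :=
  (val : {linear submodule -> V}).

Lemma submodule_incl_inj : injective submodule_incl.
Proof. exact: val_inj. Qed.

Lemma submodule_inclP x : x \in P <-> exists u, submodule_incl u = x.
Proof.
by split=> [Px|[u <-]]; [exists (Sub x Px); exact: SubK|exact: (valP u)].
Qed.

End Submodule.

Section Kernel.
Variables (S : pzRingType) (U V : lmodType S) (f : {linear U -> V}).

Definition kernel_pred : {pred U} := fun x => f x == 0.

Lemma kernel_submod_closed : submod_closed kernel_pred.
Proof.
split=> [|a x y]; rewrite !unfold_in ?linear0 // => /eqP fx /eqP fy.
by rewrite linearP fx fy scaler0 addr0.
Qed.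

HB.instance Definition _ :=
  GRing.isSubmodClosed.Build S U kernel_pred kernel_submod_closed.

Definition kernel := submodule kernel_pred.
Definition kernel_incl : {linear kernel -> U} := submodule_incl kernel_pred.

Lemma kernel_exact : exact kernel_incl f.
Proof.
move=> x; rewrite -[X in _ <-> X]submodule_inclP unfold_in.
by split=> [->//|/eqP].
Qed.

Lemma kernel_ses : (forall v, exists u, f u = v) -> short_exact kernel_incl f.
Proof.
by move=> f_surj; split; [exact: submodule_incl_inj|exact: kernel_exact|].
Qed.

End Kernel.

Section LinearFactor.
Variables (S : pzRingType) (U V W : lmodType S).

Lemma factor_through_injection (i : {linear V -> W}) (f : {linear U -> W}) :
  injective i -> (forall u, exists v, i v = f u) ->
  exists h : {linear U -> V}, forall u, i (h u) = f u.
Proof.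
move=> i_inj /choice[h hE].
have h_lin : linear h.
  by move=> a x y; apply: i_inj; rewrite linearP !hE linearP.
by exists (linear_map h_lin).
Qed.

Lemma factor_through_surjection (p : {linear U -> V}) (f : {linear U -> W}) :
  (forall v, exists u, p u = v) -> (forall u, p u = 0 -> f u = 0) ->
  exists h : {linear V -> W}, forall u, h (p u) = f u.
Proof.
move=> /choice[s sK] ker_pf.
have fE u u' : p u = p u' -> f u = f u'.
  move=> puu'; apply/eqP; rewrite -subr_eq0 -linearB; apply/eqP/ker_pf.
  by rewrite linearB puu' subrr.
have h_lin : linear (f \o s).
  by move=> a x y; rewrite /= -linearP; apply: fE; rewrite linearP !sK.
by exists (linear_map h_lin) => u; apply: fE; rewrite sK.
Qed.

End LinearFactor.

Section AdditiveCokernel.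
Variables (U V : zmodType) (f : {additive U -> V}).

Definition range_pred : {pred V} := fun v => `[< exists u, f u = v >].

Lemma range_zmod_closed : zmod_closed range_pred.
Proof.
split; first by apply/asboolP; exists 0; rewrite raddf0.
move=> _ _ /asboolP[u <-] /asboolP[v <-]; apply/asboolP.
by exists (u - v); rewrite raddfB.
Qed.

HB.instance Definition _ :=
  GRing.isZmodClosed.Build V range_pred range_zmod_closed.

Definition coker : zmodType := Quotient.quot range_pred.

Definition coker_proj (v : V) : coker := \pi_(Quotient.quot range_pred) v.

Lemma coker_projB : {morph coker_proj : v w / v - w}.
Proof. by move=> v w; exact: (raddfB (\pi_(Quotient.quot range_pred))). Qed.

HB.instance Definition _ :=
  GRing.isZmodMorphism.Build V coker coker_proj coker_projB.

Lemma coker_proj_eq v w :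
  coker_proj v = coker_proj w <-> exists u, f u = v - w.
Proof.
split=> [/eqP|h]; last apply/eqP.
  by rewrite -Quotient.idealrBE => /asboolP.
by rewrite -Quotient.idealrBE; apply/asboolP.
Qed.

Lemma coker_exact : exact f coker_proj.
Proof. by move=> v; rewrite -(raddf0 coker_proj) coker_proj_eq subr0. Qed.

Lemma coker_proj_surj q : exists v, coker_proj v = q.
Proof. by exists (repr q); exact: reprK. Qed.

End AdditiveCokernel.

Section LinearCokernel.
Variables (S : pzRingType) (U V : lmodType S) (f : {linear U -> V}).

Definition coker_scale (a : S) (q : coker f) : coker f :=
  coker_proj f (a *: repr q).

Lemma coker_scale_proj a v :
  coker_scale a (coker_proj f v) = coker_proj f (a *: v).
Proof.
apply/coker_proj_eq; have /coker_proj_eq[u fu] :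
  coker_proj f (repr (coker_proj f v)) = coker_proj f v by exact: reprK.
by exists (a *: u); rewrite -scalerBr -fu; exact: linearZ.
Qed.

Fact coker_scaleA a b q :
  coker_scale a (coker_scale b q) = coker_scale (a * b) q.
Proof.
by have [v <-] := coker_proj_surj q; rewrite !coker_scale_proj scalerA.
Qed.

Fact coker_scale1 : left_id 1 coker_scale.
Proof.
by move=> q; have [v <-] := coker_proj_surj q; rewrite coker_scale_proj scale1r.
Qed.

Fact coker_scaleDr : right_distributive coker_scale +%R.
Proof.
move=> a p q; have [v <-] := coker_proj_surj p.
have [w <-] := coker_proj_surj q.
by rewrite -raddfD !coker_scale_proj scalerDr raddfD.
Qed.

Fact coker_scaleDl q : {morph coker_scale^~ q : a b / a + b}.
Proof.
move=> a b; have [v <-] := coker_proj_surj q.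
by rewrite !coker_scale_proj scalerDl raddfD.
Qed.

(** The alias carries the module structure: [coker] only sees the additive map,
    and its scaling exists because the map is linear. *)
Definition coker_module : Type := coker f.
HB.instance Definition _ := GRing.Zmodule.on coker_module.
HB.instance Definition _ :=
  GRing.Zmodule_isLmodule.Build S coker_module
    coker_scaleA coker_scale1 coker_scaleDr coker_scaleDl.

Lemma coker_module_proj_linear : linear (coker_proj f : V -> coker_module).
Proof. by move=> a v w; rewrite raddfD /= -coker_scale_proj. Qed.

Definition coker_module_proj : {linear V -> coker_module} :=
  linear_map coker_module_proj_linear.

Lemma coker_ses : injective f -> short_exact f coker_module_proj.
Proof.
by move=> f_inj; split; [|exact: coker_exact|exact: coker_proj_surj].
Qed.

End LinearCokernel.

(** * Free modules *)

Section FreeModule.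
Variables (S : pzRingType) (T : choiceType).

Definition finite_support : {pred T -> S^o} :=
  fun c => `[< exists s : seq T, forall t, t \notin s -> c t = 0 >].

Lemma finite_support_closed : submod_closed finite_support.
Proof.
split; first by apply/asboolP; exists [::].
move=> a c c' /asboolP[s cs] /asboolP[s' cs']; apply/asboolP.
exists (s ++ s') => t; rewrite mem_cat negb_or => /andP[ts ts'].
by rewrite -[LHS]/(a *: c t + c' t) cs // cs' // scaler0 addr0.
Qed.

HB.instance Definition _ :=
  GRing.isSubmodClosed.Build S (T -> S^o) finite_support finite_support_closed.

Definition free_module := submodule finite_support.
HB.instance Definition _ := GRing.Lmodule.on free_module.

Definition coordinate (t : T) (c : free_module) : S := sval c t.

Arguments coordinate : simpl never.

Lemma coordinateB t : {morph coordinate t : c c' / c - c'}.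
Proof. by []. Qed.

HB.instance Definition _ t :=
  GRing.isZmodMorphism.Build free_module S (coordinate t) (coordinateB t).

Lemma coordinateZ t a c : coordinate t (a *: c) = a * coordinate t c.
Proof. by []. Qed.

Lemma coordinateP t a c c' :
  coordinate t (a *: c + c') = a * coordinate t c + coordinate t c'.
Proof. by []. Qed.

Fact basis_vector_finite t0 :
  ((fun t => (t == t0)%:R) : T -> S^o) \in finite_support.
Proof.
by apply/asboolP; exists [:: t0] => t; rewrite inE => /negPf->.
Qed.

Definition basis_vector (t0 : T) : free_module :=
  exist (fun c => c \in finite_support) _ (basis_vector_finite t0).

Lemma coordinate_basis t t0 : coordinate t (basis_vector t0) = (t == t0)%:R.
Proof. by []. Qed.

Definition supported_by (s : seq T) (c : free_module) : Prop :=
  uniq s /\ forall t, t \notin s -> coordinate t c = 0.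

Lemma supported_byP (c : free_module) : exists s, supported_by s c.
Proof.
have /asboolP[s cs] := valP c; exists (undup s).
by split=> [|t]; rewrite ?undup_uniq // mem_undup => /cs.
Qed.

Lemma basis_decomposition s c :
  supported_by s c -> c = \sum_(t <- s) coordinate t c *: basis_vector t.
Proof.
case=> s_uniq cs; apply/val_inj/funext=> t; rewrite -[LHS]/(coordinate t c).
rewrite -[RHS]/(coordinate t _) raddf_sum /=.
rewrite (eq_bigr (fun u => if u == t then coordinate t c else 0)); last first.
  move=> u _; rewrite /= coordinateZ coordinate_basis eq_sym.
  by case: eqP => [->|_]; rewrite ?mulr1 ?mulr0.
rewrite -big_mkcond; have [ts|ts] := boolP (t \in s).
  rewrite -big_filter (perm_big [:: t]) ?big_seq1 //.
  by apply: uniq_perm => [||u]; rewrite ?filter_uniq // !inE mem_filter;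
    case: eqP => [->|].
rewrite cs // big1_seq // => u _; exact: if_same.
Qed.

End FreeModule.
Arguments coordinate : simpl never.

Section FreeCover.
Variables (S : pzRingType) (M : lmodType S).

Local Notation F := (free_module S M).

(** The value of the covering map does not depend on the list that is chosen to
    cover the support, so that one list can be used for two vectors. *)
Lemma supported_sum s s' (c : F) : supported_by s c -> supported_by s' c ->
  \sum_(t <- s) coordinate t c *: t = \sum_(t <- s') coordinate t c *: t.
Proof.
have restrict r : \sum_(t <- r) coordinate t c *: t
    = \sum_(t <- r | coordinate t c != 0) coordinate t c *: t.
  rewrite [RHS]big_mkcond; apply: eq_bigr => t _.
  by case: eqP => [->|//]; rewrite scale0r.
move=> [us cs] [us' cs']; rewrite restrict [RHS]restrict.
rewrite -!(big_filter _ (fun t => _ != _)).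
apply: perm_big; apply: uniq_perm; rewrite ?filter_uniq // => t.
rewrite !mem_filter; case: eqP => //= ct; apply/idP/idP => _.
  by apply: contra_notT ct => /cs'.
by apply: contra_notT ct => /cs.
Qed.

Definition free_cover_fun (c : F) : M :=
  \sum_(t <- projT1 (cid (supported_byP c))) coordinate t c *: t.

Lemma free_cover_funE s c :
  supported_by s c -> free_cover_fun c = \sum_(t <- s) coordinate t c *: t.
Proof.
by rewrite /free_cover_fun; case: cid => r cr cs; exact: supported_sum.
Qed.

Lemma free_cover_is_linear : linear free_cover_fun.
Proof.
move=> a c c'; have [s [us cs]] := supported_byP c.
have [s' [us' cs']] := supported_byP c'.
pose r := undup (s ++ s').
have rP t : t \notin r -> coordinate t c = 0 /\ coordinate t c' = 0.
  by rewrite mem_undup mem_cat negb_or => /andP[/cs-> /cs'->].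
have ur : uniq r by exact: undup_uniq.
rewrite !(@free_cover_funE r); try by split=> // t /rP[].
  rewrite scaler_sumr -big_split /=; apply: eq_bigr => t _.
  by rewrite coordinateP scalerDl scalerA.
by split=> // t /rP[ct ct']; rewrite coordinateP ct ct' mulr0 addr0.
Qed.

(** The free module on the underlying set of [M], mapping the basis vector of
    [x] to [x]. *)
Definition free_cover : {linear F -> M} := linear_map free_cover_is_linear.

Lemma free_cover_surj x : exists c, free_cover c = x.
Proof.
exists (basis_vector S x).
rewrite [LHS](@free_cover_funE [:: x]).
  by rewrite big_seq1 coordinate_basis eqxx scale1r.
by split=> // t; rewrite inE coordinate_basis => /negPf->.
Qed.

Definition syzygy : lmodType S := kernel free_cover.
Definition syzygy_incl : {linear syzygy -> F} := kernel_incl free_cover.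

Lemma syzygy_ses : short_exact syzygy_incl free_cover.
Proof. exact: kernel_ses free_cover_surj. Qed.

End FreeCover.

(** * Exactness of the tensor product *)

Lemma additive_injP (U V : zmodType) (h : {additive U -> V}) :
  (forall u, h u = 0 -> u = 0) -> injective h.
Proof. exact: raddf_inj. Qed.

Lemma additive_inj0 (U V : zmodType) (h : {additive U -> V}) u :
  injective h -> h u = 0 -> u = 0.
Proof. by move=> h_inj hu; apply: h_inj; rewrite hu raddf0. Qed.

Local Notation ltensor J g := (tensor_map (idfun : {linear J -> J}) g).
Local Notation rtensor f M := (tensor_map f (idfun : {linear M -> M})).

Section Tens.
Variables (R : pzRingType) (I : lmodType R^c) (M : lmodType R).

Lemma tens0r (x : I) : tens x (0 : M) = 0.
Proof.
have [_ tD _] := tens_balanced I M.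
by apply: (addIr (tens x 0)); rewrite -tD !add0r.
Qed.

Lemma tens0l (y : M) : tens (0 : I) y = 0.
Proof.
have [tD _ _] := tens_balanced I M.
by apply: (addIr (tens 0 y)); rewrite -tD !add0r.
Qed.

Lemma tens_sumr (x : I) (T : Type) (s : seq T) (F : T -> M) :
  tens x (\sum_(t <- s) F t) = \sum_(t <- s) tens x (F t).
Proof.
have [_ tD _] := tens_balanced I M.
exact: (big_morph (tens x) (tD x) (tens0r x)).
Qed.

Lemma tens_suml (y : M) (T : Type) (s : seq T) (F : T -> I) :
  tens (\sum_(t <- s) F t) y = \sum_(t <- s) tens (F t) y.
Proof.
have [tD _ _] := tens_balanced I M.
exact: (big_morph (fun x => tens x y) (fun x x' => tD x x' y) (tens0l y)).
Qed.

End Tens.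

Section TensorFunctor.
Variable R : pzRingType.
Implicit Types (I J K : lmodType R^c) (L M N : lmodType R).

Lemma tensor_map_comp I J K L M N
    (f : {linear I -> J}) (f' : {linear J -> K}) (f'' : {linear I -> K})
    (g : {linear L -> M}) (g' : {linear M -> N}) (g'' : {linear L -> N}) :
    (forall x, f' (f x) = f'' x) -> (forall y, g' (g y) = g'' y) ->
  forall t, tensor_map f' g' (tensor_map f g t) = tensor_map f'' g'' t.
Proof.
move=> ff gg; apply: tensor_lift_unique => [s t|s t|x y]; rewrite ?raddfB //.
by rewrite !tensor_mapE ff gg.
Qed.

Lemma tensor_map_id I M (f : {linear I -> I}) (g : {linear M -> M}) :
  f =1 id -> g =1 id -> tensor_map f g =1 id.
Proof.
move=> fE gE; apply: tensor_lift_unique => [s t|//|x y]; rewrite ?raddfB //.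
by rewrite tensor_mapE fE gE.
Qed.

Lemma tensor_map_comm I J M N (f : {linear I -> J}) (g : {linear M -> N}) t :
  rtensor f N (ltensor I g t) = ltensor J g (rtensor f M t).
Proof.
rewrite (@tensor_map_comp _ _ _ _ _ _ _ _ f _ _ g) //.
by rewrite (@tensor_map_comp _ _ _ _ _ _ _ _ f _ _ g).
Qed.

Lemma tensor_map0 I J M N (f : {linear I -> J}) (g : {linear M -> N}) :
  (forall x y, tens (f x) (g y) = 0) -> forall t, tensor_map f g t = 0.
Proof.
move=> fg0; apply: (tensor_lift_unique (h' := fun=> 0)) => [s t|s t|x y].
- by rewrite raddfB.
- by rewrite subr0.
- by rewrite tensor_mapE.
Qed.

Lemma tensor_map_surj I J M N (f : {linear I -> J}) (g : {linear M -> N}) :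
    (forall y, exists x, f x = y) -> (forall y, exists x, g x = y) ->
  forall t, exists s, tensor_map f g s = t.
Proof.
move=> f_surj g_surj; elim/tensor_ind=> [|_ _ [s <-] [t <-]|x y].
- by exists 0; rewrite raddf0.
- by exists (s + t); rewrite raddfD.
- have [u <-] := f_surj x; have [v <-] := g_surj y.
  by exists (tens u v); rewrite tensor_mapE.
Qed.

Lemma ltensor_comp J L M N (g : {linear L -> M}) (h : {linear M -> N})
    (k : {linear L -> N}) :
    (forall x, k x = h (g x)) ->
  forall t, ltensor J k t = ltensor J h (ltensor J g t).
Proof.
by move=> kE t; rewrite (@tensor_map_comp _ _ _ _ _ _ _ _ idfun _ _ k).
Qed.

Lemma ltensor_surj J M N (g : {linear M -> N}) :
  (forall y, exists x, g x = y) -> forall t, exists s, ltensor J g s = t.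
Proof. by apply: tensor_map_surj => x; exists x. Qed.

(** The common core of right exactness in either variable: when [f] and [g] are
    surjective, sections of them (additive only up to the kernel of [q]) define
    a balanced map, through which [q] factors. *)
Lemma tensor_map_kernel I J M N (f : {linear I -> J}) (g : {linear M -> N})
    (Q : zmodType) (q : {additive tensor I M -> Q}) :
    (forall y, exists x, f x = y) -> (forall y, exists x, g x = y) ->
    (forall x x' y y', f x = f x' -> g y = g y' ->
       q (tens x y) = q (tens x' y')) ->
  forall t, tensor_map f g t = 0 -> q t = 0.
Proof.
move=> /choice[r rK] /choice[s sK] q_fg.
have [tD tD' tZ] := tens_balanced I M.
pose b x y := q (tens (r x) (s y)).
have b_bal : balanced b.
  split=> [x x' y|x y y'|x a y]; rewrite /b.
  - by rewrite -(raddfD q) -tD; apply: q_fg; rewrite // linearD !rK.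
  - by rewrite -(raddfD q) -tD'; apply: q_fg; rewrite // linearD !sK.
  - transitivity (q (tens ((a : R^c) *: r x) (s y))).
      by apply: q_fg; rewrite // linearZ !rK.
    by rewrite tZ; apply: q_fg; rewrite // linearZ !sK.
have qE : q =1 tensor_lift b \o tensor_map f g.
  apply: tensor_lift_unique => [t t'|t t'|x y]; first by rewrite raddfB.
    by rewrite /comp tensor_mapB tensor_liftB.
  by rewrite /= tensor_mapE tensor_liftE //; apply: q_fg; rewrite ?rK ?sK.
have lift0 : tensor_lift b 0 = 0.
  by rewrite -(subrr 0) tensor_liftB // subrr.
by move=> t; rewrite qE /= => ->.
Qed.

(** An element killed by [g] is killed by the projection to the cokernel of the
    first map, by [tensor_map_kernel]. *)
Lemma ltensor_exact J L M N (f : {linear L -> M}) (g : {linear M -> N}) :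
    exact f g -> (forall y, exists x, g x = y) ->
  exact (ltensor J f) (ltensor J g).
Proof.
move=> fg g_surj t; have [_ tD _] := tens_balanced J M; split=> [gt|[s <-]].
  apply/coker_exact; move: t gt; apply: tensor_map_kernel => // [y|x x' y y'].
    by exists y.
  move=> /= -> gyy'; apply/coker_proj_eq.
  have /fg[z fz] : g (y - y') = 0 by rewrite linearB gyy' subrr.
  exists (tens x' z); rewrite /= tensor_mapE fz; apply: (addIr (tens x' y')).
  by rewrite -tD !subrK.
rewrite (@tensor_map_comp _ _ _ _ _ _ _ _ idfun _ _ (g \o f)) //.
apply: tensor_map0 => x y /=; rewrite -[RHS](tens0r N x); congr (tens _ _).
by apply/fg; exists y.
Qed.

Lemma rtensor_exact I J K M (f : {linear I -> J}) (g : {linear J -> K}) :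
    exact f g -> (forall y, exists x, g x = y) ->
  exact (rtensor f M) (rtensor g M).
Proof.
move=> fg g_surj t; have [tD _ _] := tens_balanced J M; split=> [gt|[s <-]].
  apply/coker_exact; move: t gt; apply: tensor_map_kernel => // [y|x x' y y'].
    by exists y.
  move=> gxx' /= ->; apply/coker_proj_eq.
  have /fg[z fz] : g (x - x') = 0 by rewrite linearB gxx' subrr.
  exists (tens z y'); rewrite /= tensor_mapE fz; apply: (addIr (tens x' y')).
  by rewrite -tD !subrK.
rewrite (@tensor_map_comp _ _ _ _ _ _ _ _ (g \o f) _ _ idfun) //.
apply: tensor_map0 => x y /=; rewrite -[RHS](tens0l K y); congr (tens _ _).
by apply/fg; exists x.
Qed.

End TensorFunctor.

(** * Flat modules *)

(** Flatness of a right module, in the form in which it is used for the free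
    covers of right modules. *)
Definition right_flat (R : pzRingType) (L : lmodType R^c) : Prop :=
  forall (M N : lmodType R) (i : {linear M -> N}),
    injective i -> injective (ltensor L i).

Section Flat.
Variable R : pzRingType.

(** Right exactness is automatic, and every injection starts a short exact
    sequence. *)
Lemma flatP (M : lmodType R) : flat M <->
  forall (U V : lmodType R^c) (i : {linear U -> V}),
    injective i -> injective (rtensor i M).
Proof.
split=> [M_flat U V i /coker_ses|M_inj U V W f g [f_inj fg g_surj]].
  by case/M_flat.
split; [exact: M_inj|exact: rtensor_exact|].
by apply: tensor_map_surj => // y; exists y.
Qed.

(** A tensor with a free module is determined by its coordinates, which are
    natural in the other factor; so tensoring with a free module preserves
    injectivity.  The two variables need separate proofs because the converse of
    the converse of a ring is not convertible to it. *)
Section RightCoordinates.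
Variables (T : choiceType).
Local Notation L := (free_module R^c T).

Lemma right_coord_balanced (M : lmodType R) (t : T) :
  balanced (fun (c : L) (y : M) => ((coordinate t c : R^c) : R) *: y).
Proof.
split=> [c c' y|c y y'|c a y].
- by rewrite raddfD scalerDl.
- by rewrite scalerDr.
- by rewrite coordinateZ scalerA.
Qed.

Definition right_coord (M : lmodType R) (t : T) : tensor L M -> M :=
  tensor_lift (fun c y => ((coordinate t c : R^c) : R) *: y).

Lemma right_coordB M t : {morph @right_coord M t : u v / u - v}.
Proof. exact: tensor_liftB (right_coord_balanced M t). Qed.

HB.instance Definition _ M t :=
  GRing.isZmodMorphism.Build _ _ (@right_coord M t) (@right_coordB M t).

Lemma right_coordE (M : lmodType R) t (c : L) (y : M) :
  @right_coord M t (tens c y) = ((coordinate t c : R^c) : R) *: y.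
Proof. exact: tensor_liftE (right_coord_balanced M t) c y. Qed.

Lemma right_coord_decomposition M (u : tensor L M) : exists s : seq T,
  forall r : seq T, uniq r -> {subset s <= r} ->
  u = \sum_(t <- r) tens (basis_vector R^c t) (right_coord t u).
Proof.
have [tD tD' tZ] := tens_balanced L M.
elim/tensor_ind: u => [|u u' [s us] [s' us']|c y].
- by exists [::] => r _ _; rewrite big1 // => t _; rewrite raddf0 tens0r.
- exists (s ++ s') => r r_uniq /= sub_r.
  have [sr s'r] : {subset s <= r} /\ {subset s' <= r}.
    by split=> t ts; apply: sub_r; rewrite mem_cat ts ?orbT.
  rewrite {1}(us r) // {1}(us' r) // -big_split; apply: eq_bigr => t _.
  by rewrite raddfD tD'.
have [s [_ cs]] := supported_byP c; exists s => r r_uniq s_r.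
have cr : supported_by r c by split=> // t /(contra (s_r t))/cs.
rewrite {1}(basis_decomposition cr) tens_suml; apply: eq_bigr => t _.
by rewrite right_coordE tZ.
Qed.

Lemma right_free_flat : right_flat L.
Proof.
move=> M N i i_inj; apply: additive_injP => u iu.
have [s us] := right_coord_decomposition u.
rewrite (us (undup s)) ?undup_uniq => // [|t]; last by rewrite mem_undup.
rewrite big1 // => t _.
suff -> : right_coord t u = 0 by rewrite tens0r.
apply: i_inj; rewrite linear0 -(raddf0 (@right_coord N t)) -iu.
move: u {us iu}; apply: tensor_lift_unique => [u u'|u u'|c y].
- by rewrite !raddfB.
- by rewrite /= !raddfB.
- by rewrite /= tensor_mapE !right_coordE linearZ.
Qed.

End RightCoordinates.

Section LeftCoordinates.
Variables (T : choiceType).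
Local Notation F := (free_module R T).

Lemma left_coord_balanced (I : lmodType R^c) (t : T) :
  balanced (fun (x : I) (c : F) => ((coordinate t c : R) : R^c) *: x).
Proof.
split=> [x x' c|x c c'|x a c].
- by rewrite scalerDr.
- by rewrite raddfD scalerDl.
- by rewrite coordinateZ scalerA.
Qed.

Definition left_coord (I : lmodType R^c) (t : T) : tensor I F -> I :=
  tensor_lift (fun x c => ((coordinate t c : R) : R^c) *: x).

Lemma left_coordB I t : {morph @left_coord I t : u v / u - v}.
Proof. exact: tensor_liftB (left_coord_balanced I t). Qed.

HB.instance Definition _ I t :=
  GRing.isZmodMorphism.Build _ _ (@left_coord I t) (@left_coordB I t).

Lemma left_coordE (I : lmodType R^c) t (x : I) (c : F) :
  @left_coord I t (tens x c) = ((coordinate t c : R) : R^c) *: x.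
Proof. exact: tensor_liftE (left_coord_balanced I t) x c. Qed.

Lemma left_coord_decomposition I (u : tensor I F) : exists s : seq T,
  forall r : seq T, uniq r -> {subset s <= r} ->
  u = \sum_(t <- r) tens (left_coord t u) (basis_vector R t).
Proof.
have [tD tD' tZ] := tens_balanced I F.
elim/tensor_ind: u => [|u u' [s us] [s' us']|x c].
- by exists [::] => r _ _; rewrite big1 // => t _; rewrite raddf0 tens0l.
- exists (s ++ s') => r r_uniq /= sub_r.
  have [sr s'r] : {subset s <= r} /\ {subset s' <= r}.
    by split=> t ts; apply: sub_r; rewrite mem_cat ts ?orbT.
  rewrite {1}(us r) // {1}(us' r) // -big_split; apply: eq_bigr => t _.
  by rewrite raddfD tD.
have [s [_ cs]] := supported_byP c; exists s => r r_uniq s_r.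
have cr : supported_by r c by split=> // t /(contra (s_r t))/cs.
rewrite {1}(basis_decomposition cr) tens_sumr; apply: eq_bigr => t _.
by rewrite left_coordE tZ.
Qed.

Lemma free_flat : flat F.
Proof.
apply/flatP => U V f f_inj; apply: additive_injP => u fu.
have [s us] := left_coord_decomposition u.
rewrite (us (undup s)) ?undup_uniq => // [|t]; last by rewrite mem_undup.
rewrite big1 // => t _.
suff -> : left_coord t u = 0 by rewrite tens0l.
apply: f_inj; rewrite linear0 -(raddf0 (@left_coord V t)) -fu.
move: u {us fu}; apply: tensor_lift_unique => [u u'|u u'|x c].
- by rewrite !raddfB.
- by rewrite /= !raddfB.
- by rewrite /= tensor_mapE !left_coordE linearZ.
Qed.

End LeftCoordinates.
End Flat.

(** * Vanishing of Tor *)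

(** A diagram chase from the upper right to the lower left corner.  Both
    directions of the symmetry of Tor_1 are this lemma, applied to a 3 x 3
    diagram of tensor products and to its transpose. *)
Lemma three_by_three_injective
    (A11 A12 A13 A21 A22 A23 A31 A32 : zmodType)
    (h11 : {additive A11 -> A12}) (h12 : {additive A12 -> A13})
    (h21 : {additive A21 -> A22}) (h22 : {additive A22 -> A23})
    (h31 : {additive A31 -> A32})
    (v11 : {additive A11 -> A21}) (v12 : {additive A12 -> A22})
    (v13 : {additive A13 -> A23})
    (v21 : {additive A21 -> A31}) (v22 : {additive A22 -> A32}) :
    (forall x, v12 (h11 x) = h21 (v11 x)) ->
    (forall x, v13 (h12 x) = h22 (v12 x)) ->
    (forall x, v22 (h21 x) = h31 (v21 x)) ->
    (forall x, h12 (h11 x) = 0) -> (forall x, v22 (v12 x) = 0) ->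
    (forall z, exists y, h12 y = z) -> exact h21 h22 -> exact v11 v21 ->
    injective v12 -> injective h31 ->
  injective v13.
Proof.
move=> sq1 sq2 sq3 row1 col2 h12_surj row2 col1 v12_inj h31_inj.
apply: additive_injP => x; have [y <-] := h12_surj x.
rewrite sq2 => /row2[z hz].
have /col1[w vw] : v21 z = 0.
  by apply: (additive_inj0 h31_inj); rewrite -sq3 hz col2.
suff -> : y = h11 w by rewrite row1.
by apply: v12_inj; rewrite sq1 vw.
Qed.

Section Tor.
Variable R : pzRingType.

(** If [L] is the free cover of [J] and [N] its kernel, then Tor_1(J, M) is the
    kernel of the map from N (x) M to L (x) M. *)
Definition tor1_zero (J : lmodType R^c) (M : lmodType R) : Prop :=
  injective (rtensor (syzygy_incl J) M).

Section Balance.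
Variables (J : lmodType R^c) (K F M : lmodType R).
Variables (i : {linear K -> F}) (p : {linear F -> M}).
Hypothesis ip : short_exact i p.

Let p_surj : forall x, exists y, p y = x. Proof. by case: ip. Qed.

Let ltensor_complex (I : lmodType R^c) t : ltensor I p (ltensor I i t) = 0.
Proof.
by have [_ ex _] := ip; apply/(ltensor_exact ex p_surj); exists t.
Qed.

Let rtensor_complex (N : lmodType R) t :
  rtensor (free_cover J) N (rtensor (syzygy_incl J) N t) = 0.
Proof.
have [_ ex surj] := syzygy_ses J.
by apply/(rtensor_exact ex surj); exists t.
Qed.

(** The rows come from the free cover of [J] and the columns from [ip]; the
    middle column starts with an injection since the free cover is flat. *)
Lemma tor1_zero_injective : tor1_zero J M -> injective (ltensor J i).
Proof.
have [i_inj ex _] := ip; have [_ exJ J_surj] := syzygy_ses J.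
apply: (three_by_three_injective
  (h11 := rtensor (syzygy_incl J) K) (h12 := rtensor (free_cover J) K)
  (h21 := rtensor (syzygy_incl J) F) (h22 := rtensor (free_cover J) F)
  (v11 := ltensor _ i) (v12 := ltensor _ i)
  (v21 := ltensor _ p) (v22 := ltensor _ p)) => //.
- by move=> t; exact: esym (tensor_map_comm _ _ t).
- by move=> t; exact: esym (tensor_map_comm _ _ t).
- by move=> t; exact: esym (tensor_map_comm _ _ t).
- exact: rtensor_complex.
- exact: ltensor_complex.
- by apply: tensor_map_surj => // x; exists x.
- exact: rtensor_exact.
- exact: ltensor_exact.
- exact: right_free_flat.
Qed.

(** The transposed diagram, with the flatness of [F] in place of that of the
    free cover of [J]. *)
Lemma injective_tor1_zero : flat F -> injective (ltensor J i) -> tor1_zero J M.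
Proof.
move=> /flatP F_flat; have [_ ex _] := ip; have [J_inj exJ _] := syzygy_ses J.
apply: (three_by_three_injective
  (h11 := ltensor _ i) (h12 := ltensor _ p)
  (h21 := ltensor _ i) (h22 := ltensor _ p)
  (v11 := rtensor (syzygy_incl J) K) (v12 := rtensor (syzygy_incl J) F)
  (v21 := rtensor (free_cover J) K) (v22 := rtensor (free_cover J) F)) => //.
- exact: tensor_map_comm.
- exact: tensor_map_comm.
- exact: tensor_map_comm.
- exact: ltensor_complex.
- exact: rtensor_complex.
- by apply: tensor_map_surj => // x; exists x.
- exact: ltensor_exact.
- by apply: rtensor_exact => //; exact: free_cover_surj.
- exact: F_flat.
Qed.

End Balance.

(** Both sides are Tor_2(J, M).  Let [L] be the free cover of [J] and [N]
    its kernel.  As [F] and [L] are flat, N (x) F and L (x) K inject into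
    L (x) F; so the maps from N (x) K to these two are injective together. *)
Lemma tor1_zero_shift (J : lmodType R^c) (K F M : lmodType R)
    (i : {linear K -> F}) (p : {linear F -> M}) :
    short_exact i p -> flat F ->
  tor1_zero (syzygy J) M <-> tor1_zero J K.
Proof.
move=> ip F_flat; have [i_inj _ _] := ip; have [J_inj _ _] := syzygy_ses J.
have sq t := tensor_map_comm (syzygy_incl J) i t.
have inj_v : injective (rtensor (syzygy_incl J) F).
  by move/flatP: F_flat; apply.
have inj_h := @right_free_flat _ J _ _ i i_inj.
split=> [tor_M|inj_K].
  have inj_i := tor1_zero_injective ip tor_M.
  by move=> s t st; apply/inj_i/inj_v; rewrite !sq st.
apply: (injective_tor1_zero ip) => // s t st.
by apply: inj_K; apply: inj_h; rewrite -!sq st.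
Qed.

End Tor.

(** * Gorenstein flat modules *)

(** Every map of a complete resolution factors as a surjection onto a syzygy
    followed by an injection; this reduces its exactness, before and after
    tensoring, to that of the short exact sequences of syzygies. *)
Lemma exact_splice (T U V W X : zmodType) (q : T -> U) (j : U -> V)
    (q' : V -> W) (j' : {additive W -> X}) (h : T -> V) (h' : V -> X) :
    (forall t, h t = j (q t)) -> (forall v, h' v = j' (q' v)) ->
    (forall u, exists t, q t = u) -> exact j q' -> injective j' ->
  exact h h'.
Proof.
move=> hE hE' q_surj jq j'_inj v; split=> [|[t <-]].
  rewrite hE' => /(additive_inj0 j'_inj)/jq[u <-].
  by have [t <-] := q_surj u; exists t.
rewrite hE' -(raddf0 j') hE; congr (j' _); apply/jq; by exists (q t).
Qed.

Lemma exact_same_range (U U' V W : zmodType) (f : U -> V) (f' : U' -> V)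
    (g : V -> W) :
    (forall v, (exists u, f u = v) <-> (exists u, f' u = v)) ->
  exact f g -> exact f' g.
Proof. by move=> ff' fg v; rewrite -ff'. Qed.

(** [D] is the cokernel of [d], so that I (x) D is the cokernel of I (x) d; this
    embeds in I (x) Y as the tensored complex is exact in the middle. *)
Section ImageInjective.
Variables (R : pzRingType) (I : lmodType R^c) (X X' D Y : lmodType R).
Variables (d : {linear X -> X'}) (e : {linear X' -> Y}).
Variables (p : {linear X' -> D}) (m : {linear D -> Y}).

Lemma image_tensor_injective :
    (forall x, m (p x) = e x) -> (forall y, exists x, p x = y) -> injective m ->
    exact d e -> exact (ltensor I d) (ltensor I e) ->
  injective (ltensor I m).
Proof.
move=> mp p_surj m_inj de Ide.
have exact_dp : exact d p.
  move=> x; split=> [px|/de ex]; first by apply/de; rewrite -mp px linear0.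
  by apply: m_inj; rewrite mp ex linear0.
apply: additive_injP => t.
have [s <-] := ltensor_surj p_surj t.
rewrite /= -(ltensor_comp (k := e)) // => /Ide ts.
exact/(ltensor_exact exact_dp p_surj).
Qed.

End ImageInjective.

Definition prepend (A : Type) (a : A) (s : nat -> A) (n : nat) : A :=
  if n is k.+1 then s k else a.

Section GorensteinFlat.
Variable R : pzRingType.
Implicit Types (A B C D F M N : lmodType R).

Definition prepend_out (X0 : lmodType R) (Y : nat -> lmodType R)
    (e : {linear X0 -> Y 0%N}) (dY : forall n, {linear Y n -> Y n.+1}) n :
    {linear prepend X0 Y n -> prepend X0 Y n.+1} :=
  match n with 0 => e | k.+1 => dY k end.

Definition prepend_in (Y0 : lmodType R) (X : nat -> lmodType R)
    (e : {linear X 0%N -> Y0}) (dX : forall n, {linear X n.+1 -> X n}) n :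
    {linear prepend Y0 X n.+1 -> prepend Y0 X n} :=
  match n with 0 => e | k.+1 => dX k end.

Lemma gorenstein_flat_iso M N (h : {linear N -> M}) :
    injective h -> (forall x, exists y, h y = x) ->
  gorenstein_flat M -> gorenstein_flat N.
Proof.
move=> h_inj h_surj [X] [Y] [dX] [e] [dY] [fl ex [m [m_inj mE]] Iex].
exists X, Y, dX, e, dY; split=> //; exists (m \o h); split.
  exact: inj_comp.
move=> y; rewrite -mE; split=> [[x <-]|[x <-]]; first by exists (h x).
by have [z <-] := h_surj x; exists z.
Qed.

(** The first syzygy of a complete flat resolution is Gorenstein flat, by
    shifting the resolution by one step. *)
Lemma gorenstein_flat_surj M : gorenstein_flat M ->
  exists (X0 D1 : lmodType R) (i : {linear D1 -> X0}) (p : {linear X0 -> M}),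
  [/\ short_exact i p, flat X0, gorenstein_flat D1
    & forall I, injective_module I -> injective (ltensor I i)].
Proof.
move=> [X] [Y] [dX] [e] [dY] [fl ex [m [m_inj mE]] Iex].
have [exX exX0 exY0 exY] := ex.
have [x|p pE] := @factor_through_injection _ _ _ _ m e m_inj.
  by apply/mE; exists x.
have p_surj y : exists x, p x = y.
  have /mE[x ex'] : exists x, m x = m y by exists y.
  by exists x; apply: m_inj; rewrite pE.
have D1in z : exists w, kernel_incl p w = dX 0%N z.
  apply/kernel_exact; apply: m_inj; rewrite pE linear0.
  by apply/exX0; exists z.
have [q qE] := factor_through_injection (@submodule_incl_inj _ _ _) D1in.
have q_surj y : exists x, q x = y.
  have /exX0[x dx] : e (kernel_incl p y) = 0.
    by rewrite -pE (kernel_exact p _).2 ?linear0 //; exists y.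
  by exists x; apply: submodule_incl_inj; rewrite qE.
exists (X 0%N), (kernel p), (kernel_incl p), p; split.
- exact: kernel_ses.
- by have [] := fl 0%N.
- exists (fun n => X n.+1), (prepend (X 0%N) Y), (fun n => dX n.+1), (dX 0%N).
  exists (prepend_out e dY); split.
  + move=> n; split; first by have [] := fl n.+1.
    by case: n => [|n]; [have [] := fl 0%N|have [] := fl n].
  + split=> //; case=> //.
  + exists (kernel_incl p); split; first exact: submodule_incl_inj.
    move=> y; split=> [[x <-]|[x <-]]; last exact: D1in.
    by have [z <-] := q_surj x; exists z; rewrite qE.
  + move=> I I_inj; have [? ? ? ?] := Iex I I_inj.
    by split=> //; case.
- move=> I I_inj; have [? ? ? ?] := Iex I I_inj.
  exact: (image_tensor_injective qE q_surj (@submodule_incl_inj _ _ _)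
    (exX 0%N)).
Qed.

(** The dual shift.  The cokernel of [M -> Y 0] is realised as a kernel inside
    [Y 1]. *)
Lemma gorenstein_flat_inj M : gorenstein_flat M ->
  exists (Y0 G : lmodType R) (i : {linear M -> Y0}) (p : {linear Y0 -> G}),
  [/\ short_exact i p, flat Y0 & gorenstein_flat G].
Proof.
move=> [X] [Y] [dX] [e] [dY] [fl ex [m [m_inj mE]] Iex].
have [exX exX0 exY0 exY] := ex.
have Gin y : exists z, kernel_incl (dY 1%N) z = dY 0%N y.
  by apply/kernel_exact/exY; exists y.
have [p pE] := factor_through_injection (@submodule_incl_inj _ _ _) Gin.
exists (Y 0%N), (kernel (dY 1%N)), m, p; split.
- split=> // [y|y].
    rewrite mE -(exY0 y) -pE; split=> [->|py]; first by rewrite linear0.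
    by apply: submodule_incl_inj; rewrite linear0.
  have /exY[x dx] : dY 1%N (kernel_incl _ y) = 0.
    by apply/kernel_exact; exists y.
  by exists x; apply: submodule_incl_inj; rewrite pE.
- by have [] := fl 0%N.
exists (prepend (Y 0%N) X), (fun n => Y n.+1), (prepend_in e dX), (dY 0%N).
exists (fun n => dY n.+1); split.
- move=> n; split; last by have [] := fl n.+1.
  by case: n => [|n]; [have [] := fl 0%N|have [] := fl n].
- by split; [case=> [|n]; [exact: exX0|exact: exX]|exact: exY0|exact: exY|
    move=> n; exact: exY].
- exists (kernel_incl (dY 1%N)); split; first exact: submodule_incl_inj.
  move=> y; rewrite -(kernel_exact (dY 1%N) y); exact: exY.
- move=> I I_inj; have [IX IX0 IY0 IY] := Iex I I_inj.
  by split; [case=> [|n]; [exact: IX0|exact: IX]|exact: IY0|exact: IY|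
    move=> n; exact: IY].
Qed.

(** Tor_(n+1)(I, M) = 0 for [I] injective: shift along a complete flat
    resolution until only Tor_1 is left, where the exactness of I (x) - applies. *)
Lemma gorenstein_flat_tor (I : lmodType R^c) n M :
    injective_module I -> gorenstein_flat M ->
  tor1_zero (iter n (@syzygy R^c) I) M.
Proof.
move=> I_inj; elim: n M => [|n IHn] M /gorenstein_flat_surj
  [X0 [D1 [i [p [ip flX0 gfD1 I_i]]]]].
  by apply: (injective_tor1_zero ip) => //; exact: I_i.
by apply/(tor1_zero_shift _ ip flX0); exact: IHn.
Qed.

Lemma zero_module_flat : flat ('rV[R]_0).
Proof.
apply/flatP=> U V f _; apply: additive_injP => t _.
elim/tensor_ind: t => [//|s t -> ->|x y]; first by rewrite addr0.
by rewrite [y]thinmx0 tens0r.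
Qed.

(** The complete resolution is 0 -> F = F -> 0. *)
Lemma flat_gorenstein_flat F : flat F -> gorenstein_flat F.
Proof.
move=> F_flat; pose Z : lmodType R := 'rV[R]_0.
pose s := prepend F (fun=> Z).
exists s, s, (fun n => \0 : {linear _ -> _}), (idfun : {linear F -> F}).
exists (fun n => \0 : {linear _ -> _}).
have s0 n (z : s n.+1) : z = 0 by exact: thinmx0.
have Is0 (I : lmodType R^c) n (t : tensor I (s n.+1)) : t = 0.
  elim/tensor_ind: t => [//|t t' -> ->|x y]; first by rewrite addr0.
  by rewrite [y]s0 tens0r.
have Imap0 (I : lmodType R^c) (M N : lmodType R) t :
    ltensor I (\0 : {linear M -> N}) t = 0.
  by apply: tensor_map0 => x y; rewrite tens0r.
have Iid (I : lmodType R^c) : ltensor I (idfun : {linear F -> F}) =1 id.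
  exact: tensor_map_id.
split.
- by case=> [|n]; split=> //; exact: zero_module_flat.
- split=> [n|x|x|n] //=.
  + by move=> x; rewrite [x](s0 n); split=> // _; exists 0.
  + by split=> [->|[z <-]] //; exists 0.
  + by split=> // _; exists x.
  + by move=> x; rewrite [x](s0 n); split=> // _; exists 0.
- by exists (idfun : {linear F -> F}); split.
- move=> I _; split=> [n|x|x|n].
  + move=> x; rewrite [x](Is0 _ n) raddf0; split=> // _.
    by exists 0; exact: raddf0.
  + rewrite Iid; split=> [->|[z <-]]; last exact: Imap0.
    by exists 0; rewrite raddf0.
  + split=> [_|_]; last exact: Imap0.
    by exists x; rewrite Iid.
  + move=> x; rewrite [x](Is0 _ n) raddf0; split=> // _.
    by exists 0; exact: raddf0.
Qed.

(** A complete flat resolution of [A] is spliced from the canonical free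
    resolution of [A] and the right half of the one of [D], with [F] in between.
    Since Tor_(n+1)(I, A) = Tor_(n+2)(I, D) = 0, all syzygies of [A] stay exact
    under I (x) -. *)
Lemma gorenstein_flat_flat_syzygy A F D (i : {linear A -> F})
    (p : {linear F -> D}) :
  short_exact i p -> flat F -> gorenstein_flat D -> gorenstein_flat A.
Proof.
move=> ip F_flat D_gf.
(* Recorded before the resolution of D is opened, which consumes the
   hypothesis. *)
have D_tor := fun I n (I_inj : injective_module I) =>
  @gorenstein_flat_tor I n D I_inj D_gf.
case: D_gf => [X] [Y] [dX] [e] [dY] [fl ex [m [m_inj mE]] Iex].
have [exX exX0 exY0 exY] := ex; have [i_inj exip p_surj] := ip.
have A_tor I n k : injective_module I ->
    tor1_zero (iter n (@syzygy R^c) I) (iter k (@syzygy R) A).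
  move=> I_inj; elim: k n => [|k IHk] n.
    by apply/(tor1_zero_shift _ ip F_flat); exact: (D_tor I n.+1).
  apply/(tor1_zero_shift _ (syzygy_ses _) (free_flat _)).
  exact: (IHk n.+1).
have [x|q qE] := @factor_through_injection _ _ _ _ m e m_inj.
  by apply/mE; exists x.
have q_surj y : exists x, q x = y.
  have /mE[x ex'] : exists x, m x = m y by exists y.
  by exists x; apply: m_inj; rewrite qE.
pose Z k := iter k (@syzygy R) A.
pose r := m \o p : {linear F -> Y 0%N}.
pose dX' k : {linear free_module R (Z k.+1) -> free_module R (Z k)} :=
  syzygy_incl (Z k) \o free_cover (Z k.+1).
pose e' : {linear free_module R (Z 0%N) -> F} := i \o free_cover A.
have r_exact : exact r (dY 0%N).
  apply: exact_same_range exY0 => y; split=> -[x <-].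
    by have [z pz] := p_surj (q x); exists z; rewrite /= pz qE.
  by have [z qz] := q_surj (p x); exists z; rewrite -qE qz.
exists (fun k => free_module R (Z k)), (prepend F Y), dX', e'.
exists (prepend_out r dY); split.
- by move=> n; split; [exact: free_flat|case: n => [|n] //; have [] := fl n].
- split=> [n|||[|n]] //.
  + apply: (exact_splice (q := free_cover (Z n.+2))
      (j := syzygy_incl (Z n.+1)) (q' := free_cover (Z n.+1))
      (j' := syzygy_incl (Z n))) => //.
    * exact: free_cover_surj.
    * by have [_ ex' _] := syzygy_ses (Z n.+1).
  + apply: (exact_splice (q := free_cover (Z 1%N)) (j := syzygy_incl A)
      (q' := free_cover A) (j' := i)) => //.
    * exact: free_cover_surj.
    * by have [_ ex' _] := syzygy_ses A.
  + apply: (exact_splice (q := free_cover A) (j := i) (q' := p)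
      (j' := m)) => //.
    exact: free_cover_surj.
  + exact: exY.
- exists i; split=> // y; split=> -[x <-]; last by exists (free_cover A x).
  by have [z <-] := free_cover_surj x; exists z.
move=> I I_inj; have [IX IX0 IY0 IY] := Iex I I_inj.
have Z_exact k :
    exact (ltensor I (syzygy_incl (Z k))) (ltensor I (free_cover (Z k))).
  by have [_ ex' surj] := syzygy_ses (Z k); exact: ltensor_exact.
have Z_inj k : injective (ltensor I (syzygy_incl (Z k))).
  exact: tor1_zero_injective (syzygy_ses _) (A_tor I 0%N k I_inj).
have i_Iinj : injective (ltensor I i).
  exact: tor1_zero_injective ip (D_tor I 0%N I_inj).
have m_Iinj : injective (ltensor I m).
  exact: (image_tensor_injective qE q_surj m_inj exX0).
split=> [n|||[|n]] //.
- apply: (exact_splice (q := ltensor I (free_cover (Z n.+2)))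
    (j := ltensor I (syzygy_incl (Z n.+1)))
    (q' := ltensor I (free_cover (Z n.+1)))
    (j' := ltensor I (syzygy_incl (Z n)))) => [t|t|||].
  + exact: ltensor_comp.
  + exact: ltensor_comp.
  + exact: ltensor_surj (@free_cover_surj _ _).
  + exact: Z_exact.
  + exact: Z_inj.
- apply: (exact_splice (q := ltensor I (free_cover (Z 1%N)))
    (j := ltensor I (syzygy_incl A)) (q' := ltensor I (free_cover A))
    (j' := ltensor I i)) => [t|t|||].
  + exact: ltensor_comp.
  + exact: ltensor_comp.
  + exact: ltensor_surj (@free_cover_surj _ _).
  + exact: (Z_exact 0%N).
  + exact: i_Iinj.
- apply: (exact_splice (q := ltensor I (free_cover A)) (j := ltensor I i)
    (q' := ltensor I p) (j' := ltensor I m)) => [t|t|||].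
  + exact: ltensor_comp.
  + exact: ltensor_comp.
  + exact: ltensor_surj (@free_cover_surj _ _).
  + exact: ltensor_exact.
  + exact: m_Iinj.
- apply: exact_same_range IY0 => y; split=> -[x <-].
    have [z pz] := ltensor_surj p_surj (ltensor I q x); exists z.
    rewrite (ltensor_comp (k := r) (g := p) (h := m)) // pz.
    by rewrite -(ltensor_comp (k := e)).
  have [z qz] := ltensor_surj q_surj (ltensor I p x); exists z.
  rewrite (ltensor_comp (k := e) (g := q) (h := m)) // qz.
  by rewrite -(ltensor_comp (k := r)).
- exact: IY.
Qed.

(** Embed [B] in a flat module [F] with Gorenstein flat cokernel [G].  Then
    [F / A] is an extension of [G] by [C], and [A] is the kernel of
    [F -> F / A]. *)
Lemma gorenstein_flat_kernel (hR : left_GF_closed R) A B C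
    (f : {linear A -> B}) (g : {linear B -> C}) :
  short_exact f g -> gorenstein_flat B -> gorenstein_flat C ->
  gorenstein_flat A.
Proof.
move=> [f_inj fg g_surj] /gorenstein_flat_inj.
move=> [F [G [i [p [ip F_flat G_gf]]]]] C_gf.
have [i_inj exip p_surj] := ip.
have if_inj : injective (i \o f : {linear A -> F}) by exact: inj_comp.
have [D [pi SD]] : exists (D : lmodType R) (pi : {linear F -> D}),
    short_exact (i \o f) pi.
  by exists (coker_module (i \o f)), (coker_module_proj _); exact: coker_ses.
have [_ exD D_surj] := SD.
apply: (gorenstein_flat_flat_syzygy SD F_flat).
have [b|c cE] := factor_through_surjection (p := g)
    (f := pi \o i) g_surj.
  by move/fg=> [a <-]; apply/exD; exists a.
have [x|d dE] := factor_through_surjection (p := pi) (f := p) D_surj.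
  by move/exD=> [a <-]; apply/exip; exists (f a).
apply: (hR _ _ _ c d) C_gf G_gf; split.
- apply: additive_injP => z; have [b <-] := g_surj z.
  rewrite [LHS]cE => /exD[a /i_inj <-]; apply/fg; by exists a.
- move=> y; have [x <-] := D_surj y; rewrite dE; split=> [/exip[b <-]|[z]].
    by exists (g b); rewrite cE.
  have [b <-] := g_surj z; rewrite cE => cx.
  by rewrite -dE -cx dE; apply/exip; exists b.
- by move=> y; have [x <-] := p_surj y; exists (pi x).
Qed.

End GorensteinFlat.

(** * Gorenstein flat dimension *)

Section Diagrams.
Variable R : pzRingType.
Implicit Types (A B C D F G K L : lmodType R).

Lemma pullback_ses A B C G K (a : {linear A -> B}) (b : {linear B -> C})
    (k : {linear K -> G}) (c : {linear G -> C}) :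
    short_exact a b -> short_exact k c ->
  exists (P : lmodType R) (k' : {linear K -> P}) (b' : {linear P -> B})
         (a' : {linear A -> P}) (c' : {linear P -> G}),
    short_exact k' b' /\ short_exact a' c'.
Proof.
move=> [a_inj ab b_surj] [k_inj kc c_surj].
have diff_lin : linear (fun x : (B * G)%type => b x.1 - c x.2).
  by move=> r x y; rewrite /= !linearP scalerBr addrACA scalerN.
pose diff := linear_map diff_lin; pose P := kernel diff.
pose fst_lin : {linear P -> B} := fst \o kernel_incl diff.
pose snd_lin : {linear P -> G} := snd \o kernel_incl diff.
have fstE x : fst_lin x = (kernel_incl diff x).1 by [].
have sndE x : snd_lin x = (kernel_incl diff x).2 by [].
have P_square x : b (fst_lin x) = c (snd_lin x).
  apply/eqP; rewrite -subr_eq0; apply/eqP.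
  by apply: (kernel_exact diff (kernel_incl diff x)).2; exists x.
have P_intro y z : b y = c z -> exists x, kernel_incl diff x = (y, z).
  by move=> yz; apply/kernel_exact; rewrite -[LHS]/(b y - c z) yz subrr.
have P_inj := @submodule_incl_inj _ _ (kernel_pred diff).
have in1_lin : linear (fun x : A => (a x, 0) : (B * G)%type).
  by move=> r x y; rewrite linearP; congr pair; rewrite /= scaler0 addr0.
have in2_lin : linear (fun x : K => (0, k x) : (B * G)%type).
  by move=> r x y; rewrite linearP; congr pair; rewrite /= scaler0 addr0.
have [x|a' a'E] := factor_through_injection (f := linear_map in1_lin) P_inj.
  by apply: P_intro; rewrite linear0; apply/ab; exists x.
have [x|k' k'E] := factor_through_injection (f := linear_map in2_lin) P_inj.
  by apply: P_intro; rewrite linear0; apply/esym/kc; exists x.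
exists P, k', fst_lin, a', snd_lin; split; split.
- move=> x y /(congr1 (kernel_incl diff)); rewrite !k'E => -[].
  exact: k_inj.
- move=> x; split=> [x1|[z <-]]; last by rewrite fstE k'E.
  have /kc[z kz] : c (snd_lin x) = 0 by rewrite -P_square x1 linear0.
  exists z; apply: P_inj.
  by rewrite k'E [RHS]surjective_pairing -fstE -sndE x1 -kz.
- move=> y; have [z cz] := c_surj (b y); have [x xE] := P_intro y z (esym cz).
  by exists x; rewrite fstE xE.
- move=> x y /(congr1 (kernel_incl diff)); rewrite !a'E => -[].
  exact: a_inj.
- move=> x; split=> [x2|[z <-]]; last by rewrite sndE a'E.
  have /ab[z az] : b (fst_lin x) = 0 by rewrite P_square x2 linear0.
  exists z; apply: P_inj.
  by rewrite a'E [RHS]surjective_pairing -fstE -sndE x2 -az.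
- move=> z; have [y by_] := b_surj (c z); have [x xE] := P_intro y z by_.
  by exists x; rewrite sndE xE.
Qed.

(** The rotation 0 -> ker phi -> ker (g phi) -> A -> 0: [phi] maps the kernel of
    its composite with [g] onto the kernel of [g]. *)
Lemma kernel_comp_ses A B C F K L (f : {linear A -> B}) (g : {linear B -> C})
    (phi : {linear F -> B}) (psi : {linear F -> C})
    (k : {linear K -> F}) (l : {linear L -> F}) :
    short_exact f g -> short_exact k phi -> short_exact l psi ->
    (forall x, psi x = g (phi x)) ->
  exists (i : {linear K -> L}) (p : {linear L -> A}), short_exact i p.
Proof.
move=> [f_inj fg g_surj] [k_inj kphi phi_surj] [l_inj lpsi psi_surj] psiE.
have [x|i iE] := factor_through_injection (f := k) l_inj.
  by apply/lpsi; rewrite psiE (kphi _).2 ?linear0 //; exists x.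
have [x|p pE] := factor_through_injection (f := phi \o l) f_inj.
  by apply/fg; rewrite /= -psiE; apply/lpsi; exists x.
exists i, p; split.
- by move=> x y /(congr1 l); rewrite !iE => /k_inj.
- move=> x; split=> [px|[y <-]].
    have /kphi[y yE] : phi (l x) = 0 by rewrite -[LHS]pE px linear0.
    by exists y; apply: l_inj; rewrite iE.
  by apply: f_inj; rewrite pE linear0 /= iE; apply/kphi; exists y.
- move=> x; have [y yE] := phi_surj (f x).
  have /lpsi[z zE] : psi y = 0 by rewrite psiE yE; apply/fg; exists x.
  by exists z; apply: f_inj; rewrite pE /= zE.
Qed.

End Diagrams.

Section Dimension.
Variable R : pzRingType.
Implicit Types (A B C D F G K L M : lmodType R).

Lemma gfd_le0 M : gfd_le M 0 <-> gorenstein_flat M.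
Proof.
split=> [[G [d [aug [G_gf G0 exd exaug aug_surj]]]]|M_gf].
  have aug_inj : injective aug.
    apply: additive_injP => x /exaug[y <-].
    by rewrite (G0 1%N isT y) linear0.
  have [x|h hE] :=
      factor_through_injection (f := (idfun : {linear M -> M})) aug_inj.
    exact: aug_surj.
  apply: (gorenstein_flat_iso (h := h) _ _ (G_gf 0%N isT)).
    by move=> x y /(congr1 aug); rewrite !hE.
  by move=> y; exists (aug y); apply: aug_inj; rewrite hE.
pose G := prepend M (fun=> 'rV[R]_0 : lmodType R).
exists G, (fun n => \0 : {linear _ -> _}), (idfun : {linear M -> M}).
have G0 n (x : G n.+1) : x = 0 by exact: thinmx0.
split.
- by case.
- by case=> // i _; exact: G0.
- by move=> i x; rewrite [x](G0 i); split=> // _; exists 0.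
- by move=> x; split=> [/= ->|[y <-]] //; exists 0.
- by move=> x; exists x.
Qed.

Lemma gfd_leS M n : gfd_le M n.+1 <->
  exists (K G : lmodType R) (i : {linear K -> G}) (p : {linear G -> M}),
    [/\ short_exact i p, gorenstein_flat G & gfd_le K n].
Proof.
split=> [[G [d [aug [G_gf G0 exd exaug aug_surj]]]]|].
  exists (kernel aug), (G 0%N), (kernel_incl aug), aug; split.
  - exact: kernel_ses.
  - exact: G_gf.
  have K_inj := @submodule_incl_inj _ _ (kernel_pred aug).
  have [x|h hE] := factor_through_injection (f := d 0%N) K_inj.
    by apply/kernel_exact/exaug; exists x.
  exists (fun i => G i.+1), (fun i => d i.+1), h; split=> [i|i|i|x|x].
  - exact: (G_gf i.+1).
  - exact: (G0 i.+1).
  - exact: exd.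
  - rewrite -(exd 0%N x) -hE; split=> [->|hx]; first by rewrite linear0.
    by apply: K_inj; rewrite hx linear0.
  - have /exaug[y dy] : aug (kernel_incl aug x) = 0.
      by apply/kernel_exact; exists x.
    by exists y; apply: K_inj; rewrite hE.
move=> [K [G0 [i [p [[i_inj ip p_surj] G0_gf]]]]].
move=> [G [d [aug [G_gf Gz exd exaug aug_surj]]]].
exists (prepend G0 G), (prepend_in (i \o aug : {linear G 0%N -> G0}) d), p.
split=> //.
- by case=> [|j] // /G_gf.
- by case=> [|j] // /Gz.
- case=> [|j]; last exact: exd.
  move=> x; rewrite -(exaug x) /=; split=> [|->]; last by rewrite linear0.
  exact: additive_inj0.
- move=> x; rewrite ip; split=> [[y <-]|[y <-]]; last by exists (aug y).
  by have [z <-] := aug_surj y; exists z.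
Qed.

Lemma free_gorenstein_flat (T : choiceType) : gorenstein_flat (free_module R T).
Proof. by apply: flat_gorenstein_flat; exact: free_flat. Qed.

Section Closed.
Hypothesis hR : left_GF_closed R.

Lemma gfd_le_step M n : gfd_le M n -> gfd_le M n.+1.
Proof.
elim: n M => [|n IHn] M.
  move/gfd_le0=> M_gf; apply/gfd_leS.
  exists (syzygy M), (free_module R M), (syzygy_incl M), (free_cover M).
  split; [exact: syzygy_ses|exact: free_gorenstein_flat|apply/gfd_le0].
  exact: gorenstein_flat_kernel (syzygy_ses M) (free_gorenstein_flat _) M_gf.
move/gfd_leS=> [K [G [i [p [ip G_gf K_le]]]]]; apply/gfd_leS.
by exists K, G, i, p; split=> //; exact: IHn.
Qed.

Lemma gfd_le_monotone M m n : (m <= n)%N -> gfd_le M m -> gfd_le M n.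
Proof.
by move=> /subnK<-; elim: (n - m)%N => // k IHk /IHk/gfd_le_step.
Qed.

(** If [G -> B] starts a resolution of [B], then the kernel of [G -> B -> C] is
    Gorenstein flat and maps onto [A] with the same kernel as [G -> B]. *)
Lemma gfd_le_kernel_to_gf A B C n (f : {linear A -> B}) (g : {linear B -> C}) :
  short_exact f g -> gorenstein_flat C -> gfd_le B n -> gfd_le A n.
Proof.
case: n => [|n] fg C_gf.
  by move/gfd_le0=> B_gf; apply/gfd_le0; exact: gorenstein_flat_kernel fg _ _.
move/gfd_leS=> [K [G [i [p [ip G_gf K_le]]]]]; apply/gfd_leS.
have gp_surj z : exists x, (g \o p) x = z.
  have [_ _ g_surj] := fg; have [_ _ p_surj] := ip.
  by have [y <-] := g_surj z; have [x <-] := p_surj y; exists x.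
have SL := kernel_ses gp_surj.
have [j [q jq]] := kernel_comp_ses fg ip SL (fun=> erefl).
exists K, (kernel (g \o p)), j, q; split=> //.
exact: gorenstein_flat_kernel SL G_gf C_gf.
Qed.

Definition extension_bound n := forall A B C (f : {linear A -> B})
    (g : {linear B -> C}),
  short_exact f g -> gfd_le A n -> gfd_le C n -> gfd_le B n.

Definition kernel_bound n := forall A B C (f : {linear A -> B})
    (g : {linear B -> C}),
  short_exact f g -> gfd_le B n -> gfd_le C n.+1 -> gfd_le A n.

(** A resolution of [C] starts with some Gorenstein flat [G], not with [B]; the
    pullback [P] of the two compares them.  It is an extension of [B] by a
    module of dimension at most [n], and [A] is the kernel of [P -> G]. *)
Lemma syzygy_bound n : extension_bound n ->
  forall A B C (f : {linear A -> B}) (g : {linear B -> C}),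
  short_exact f g -> gorenstein_flat B -> gfd_le C n.+1 -> gfd_le A n.
Proof.
move=> ext_n A B C f g fg B_gf /gfd_leS[K [G [i [p [ip G_gf K_le]]]]].
have [P [i' [b' [a' [c' [SK SA]]]]]] := pullback_ses fg ip.
apply: (gfd_le_kernel_to_gf SA G_gf); apply: (ext_n _ _ _ _ _ SK K_le).
by apply: gfd_le_monotone (leq0n n) _; apply/gfd_le0.
Qed.

Lemma common_free_cover A B C (f : {linear A -> B}) (g : {linear B -> C}) :
    short_exact f g ->
  exists (F N D : lmodType R)
    (k : {linear N -> F}) (phi : {linear F -> B})
    (l : {linear D -> F}) (psi : {linear F -> C})
    (i : {linear N -> D}) (p : {linear D -> A}),
  [/\ gorenstein_flat F, short_exact k phi, short_exact l psi
    & short_exact i p].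
Proof.
move=> fg; have SB := syzygy_ses B.
have psi_surj z : exists x, (g \o free_cover B) x = z.
  have [_ _ g_surj] := fg; have [y <-] := g_surj z.
  by have [x <-] := free_cover_surj y; exists x.
have SL := kernel_ses psi_surj.
have [i [p ip]] := kernel_comp_ses fg SB SL (fun=> erefl).
exists (free_module R B), (syzygy B), (kernel (g \o free_cover B)).
exists (syzygy_incl B), (free_cover B), (kernel_incl _), (g \o free_cover B).
by exists i, p; split=> //; exact: free_gorenstein_flat.
Qed.

(** After rotation, the syzygy [D] of [C] is an extension of [A] by the syzygy
    [N] of [B]. *)
Lemma cokernel_bound n : extension_bound n ->
  forall A B C (f : {linear A -> B}) (g : {linear B -> C}),
  short_exact f g -> gfd_le A n -> gfd_le B n.+1 -> gfd_le C n.+1.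
Proof.
move=> ext_n A B C f g fg A_le B_le.
have [F [N [D [k [phi [l [psi [i [p [F_gf SN SD ip]]]]]]]]]] :=
  common_free_cover fg.
have N_le : gfd_le N n by exact: (syzygy_bound ext_n SN F_gf).
by apply/gfd_leS; exists D, F, l, psi; split=> //; exact: (ext_n _ _ _ _ _ ip).
Qed.

(** In degree [n.+1], extensions rotate to kernels in degree [n], and kernels
    rotate to cokernels, which are extensions in degree [n]. *)
Lemma extension_kernel_bound n : extension_bound n /\ kernel_bound n.
Proof.
elim: n => [|n [ext_n ker_n]].
  have ext0 : extension_bound 0.
    move=> A B C f g fg /gfd_le0 A_gf /gfd_le0 C_gf; apply/gfd_le0.
    exact: hR fg A_gf C_gf.
  by split=> // A B C f g fg /gfd_le0; exact: (syzygy_bound ext0 fg).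
have ext_S : extension_bound n.+1.
  move=> A B C f g fg A_le C_le; apply/gfd_leS.
  have [F [N [D [k [phi [l [psi [i [p [F_gf SN SD ip]]]]]]]]]] :=
    common_free_cover fg.
  exists N, F, k, phi; split=> //; apply: (ker_n _ _ _ _ _ ip) => //.
  exact: (syzygy_bound ext_n SD F_gf).
split=> // A B C f g fg B_le C_le.
have [F [N [D [k [phi [l [psi [i [p [F_gf SN SD ip]]]]]]]]]] :=
  common_free_cover fg.
apply: (cokernel_bound ext_n ip); first exact: (syzygy_bound ext_n SN F_gf).
exact: (syzygy_bound ext_S SD F_gf).
Qed.

End Closed.
End Dimension.

Section GfdValue.
Variable R : pzRingType.
Hypothesis hR : left_GF_closed R.

(** The upward closure of the bounds on the dimension, which holds over a
    GF-closed ring, lets the least bound determine all of them. *)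
Variant gfd_spec (M : lmodType R) : \bar int -> Prop :=
| GfdFinite n of (forall k, gfd_le M k <-> (n <= k)%N) : gfd_spec M (n%:Z)%:E
| GfdInfinite of (forall k, ~ gfd_le M k) : gfd_spec M +oo%E.

Lemma GfdP M : gfd_spec M (Gfd M).
Proof.
rewrite /Gfd; case: pselect => [h|h].
  constructor; case: ex_minnP => n /asboolP n_le n_min k; split.
    by move=> k_le; apply: n_min; apply/asboolP.
  by move=> nk; exact: gfd_le_monotone nk n_le.
by constructor=> k k_le; apply: h; exists k; apply/asboolP.
Qed.

End GfdValue.

Local Open Scope ereal_scope.

Theorem theorem2p11 (R : pzRingType) (hR : left_GF_closed R)
    (A B C : lmodType R) (f : {linear A -> B}) (g : {linear B -> C})
    (hfg : short_exact f g) :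
  ((Gfd A < +oo -> Gfd B < +oo -> Gfd C < +oo) /\
   (Gfd A < +oo -> Gfd C < +oo -> Gfd B < +oo) /\
   (Gfd B < +oo -> Gfd C < +oo -> Gfd A < +oo)) /\
  (Gfd A <= Order.max (Gfd B) (Gfd C - 1) /\
   (Gfd B <> Gfd C -> Gfd A = Order.max (Gfd B) (Gfd C - 1))) /\
  (Gfd B <= Order.max (Gfd A) (Gfd C) /\
   (Gfd C <> Gfd A + 1 -> Gfd B = Order.max (Gfd A) (Gfd C))) /\
  (Gfd C <= Order.max (Gfd B) (Gfd A + 1) /\
   (Gfd B <> Gfd A -> Gfd C = Order.max (Gfd B) (Gfd A + 1))).
Proof.
have ext n := (extension_kernel_bound hR n).1 _ _ _ _ _ hfg.
have ker n := (extension_kernel_bound hR n).2 _ _ _ _ _ hfg.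
have cok n := cokernel_bound hR (extension_kernel_bound hR n).1 hfg.
have addoo : +oo + 1 = +oo :> \bar int by [].
have suboo : +oo - 1 = +oo :> \bar int by [].
have fin_lt n : (n%:Z)%:E < +oo by exact: ltry.
(* If two of the dimensions are finite, so is the third, which excludes the
   three cases with exactly one infinite value. *)
case: (GfdP hR A) => [a aP|aP]; case: (GfdP hR B) => [b bP|bP];
  case: (GfdP hR C) => [c cP|cP].
- have leA : (a <= maxn b c.-1)%N.
    apply/aP/ker; first by apply/bP; exact: leq_maxl.
    by apply/cP; lia.
  have leB : (b <= maxn a c)%N.
    by apply/bP/ext; [apply/aP; exact: leq_maxl|apply/cP; exact: leq_maxr].
  have leC : (c <= (maxn b.-1 a).+1)%N.
    by apply/cP/cok; [apply/aP; lia|apply/bP; lia].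
  rewrite -EFinB -EFinD -!EFin_max !lee_fin.
  have EFin_neq m n : (m%:Z)%:E <> (n%:Z)%:E -> m <> n.
    by move=> mn e; rewrite e in mn.
  split; first by [].
  split; [split; [lia|move/EFin_neq=> ?; congr EFin; lia]|].
  split; [split; [lia|move=> ca; congr EFin]|].
    have : c <> a.+1 by move=> e; apply: ca; rewrite e -addn1 PoszD.
    lia.
  by split; [lia|move/EFin_neq=> ?; congr EFin; lia].
- by case: (cP (maxn a b).+1); apply: cok; [apply/aP|apply/bP]; lia.
- by case: (bP (maxn a c)); apply: ext; [apply/aP|apply/cP]; lia.
- by rewrite !(addoo, suboo, maxye, maxey, leey); intuition.
- by case: (aP (maxn b c)); apply: ker; [apply/bP|apply/cP]; lia.
- by rewrite !(addoo, suboo, maxye, maxey, leey); intuition.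
- by rewrite !(addoo, suboo, maxye, maxey, leey); intuition.
- by rewrite !(addoo, suboo, maxye, maxey, leey); intuition.
Qed.
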